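(* The polytope $\mathcal P_\Phi$ is the intersection of the half-spaces $\{x\mid(x,w\breve\omega_i)\leq m_i\}$ over all $w\in W$ and all $i\in\{1,\dots,n\}$. A minimal half-space representation of $\mathcal P_\Phi$ (i.e. a set of half-spaces with intersection $\mathcal P_\Phi$ such that no proper subset has intersection $\mathcal P_\Phi$) is obtained by taking the half-spaces $\{x\mid(x,w\breve\omega_i)\leq m_i\}$ with $w\in W$ and only those $i\in\{1,\dots,n\}$ such that $\widehat\Phi(\widehat\Pi\setminus\{\alpha_i\})$ is irreducible.
   Context: $\Phi$ is a finite irreducible reduced crystallographic root system of rank $n$ in the Euclidean space $\mathrm{Span}_{\mathbb R}\Phi$ with scalar product $(\cdot,\cdot)$; $\Pi=\{\alpha_1,\dots,\alpha_n\}$ is a root basis, $W$ the Weyl group, $\theta=\sum_{i=1}^n m_i\alpha_i$ the highest root, and $\breve\omega_1,\dots,\breve\omega_n$ the basis dual to $\Pi$, i.e. $(\breve\omega_i,\alpha_j)=\delta_{ij}$. $\mathcal P_\Phi$ is the convex hull of $\Phi$. Affine root system: in $\mathrm{Span}_{\mathbb R}\Phi\oplus\mathbb R\delta$, with the scalar product extended so that $\mathbb R\delta$ is the kernel, $\widehat\Phi=\{\alpha+k\delta\mid\alpha\in\Phi,k\in\mathbb Z\}$, $\alpha_0=-\theta+\delta$, $\widehat\Pi=\Pi\cup\{\alpha_0\}$. For $\Gamma\subseteq\widehat\Pi$, $\widehat\Phi(\Gamma)$ is the standard parabolic root subsystem of $\widehat\Phi$ generated by $\Gamma$; it is irreducible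 iff $\Gamma$ is connected in the extended Dynkin diagram. Half-spaces are considered as a set (repetitions coming from different $w$ giving the same vector $w\breve\omega_i$ are counted once). *)

(* Defs.v *)
From HB Require Import structures.
From mathcomp Require Import all_boot all_order all_algebra sesquilinear.
From mathcomp Require Import mathcomp_extra boolp classical_sets functions.
From mathcomp Require Import cardinality reals convex.

Set Implicit Arguments.
Unset Strict Implicit.
Unset Printing Implicit Defensive.

Import Order.TTheory GRing.Theory Num.Theory.

Local Open Scope classical_set_scope.
Local Open Scope ring_scope.

(* These notions only involve a bilinear form, possibly degenerate, so that
   they apply both to the Euclidean space and to its affine extension. *)
Section Reflections.
Context {R : realType} {E : lmodType R}.
Variable f : E -> E -> R.

Definition refl (a x : E) : E := x - (2 * f x a / f a a) *: a.

Definition refl_stable (S : set E) : Prop :=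
  forall a b, S a -> S b -> S (refl a b).

(* Reflections in non-isotropic vectors are involutions, so closure under
   inverses is automatic. *)
Inductive refl_group (S : set E) : set (E -> E) :=
| refl_group1 : refl_group S id
| refl_groupM a w : S a -> refl_group S w -> refl_group S (refl a \o w).

Definition irreducible_roots (S : set E) : Prop :=
  S !=set0 /\
  ~ (exists A B : set E, [/\ A !=set0, B !=set0, S = A `|` B &
       forall a b, A a -> B b -> f a b = 0]).

Definition generated_subsystem (S G : set E) : set E :=
  smallest (fun T => T `<=` S /\ refl_stable T) G.

End Reflections.

Section RootSystem.
Context {R : realType} {V : vectType R}.
Variable dot : {dot V for (idfun : R -> R)}.

Record reduced_root_system (Phi : set V) : Prop := {
  root_finite : finite_set Phi;
  root_neq0 : ~ Phi 0;
  root_span : forall U : {vspace V}, Phi `<=` [set x | x \in U] -> U = fullv;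
  root_refl : refl_stable dot Phi;
  root_int : forall a b, Phi a -> Phi b ->
    exists k : int, 2 * dot b a / dot a a = k%:~R;
  root_reduced : forall a (c : R), Phi a -> Phi (c *: a) -> c = 1 \/ c = -1
}.

Definition weyl_group (Phi : set V) : set (V -> V) := refl_group dot Phi.

Section Basis.
Variables (n : nat) (Phi : set V) (alpha : 'I_n -> V).

Definition pos_comb (x : V) : Prop :=
  exists c : 'I_n -> nat, x = \sum_i alpha i *+ c i.

Record root_basis : Prop := {
  root_basis_root : forall i, Phi (alpha i);
  root_basis_basis : basis_of fullv [seq alpha i | i : 'I_n];
  root_basis_sign : forall b, Phi b -> pos_comb b \/ pos_comb (- b)
}.

Definition highest_root (theta : V) : Prop :=
  Phi theta /\ forall b, Phi b -> pos_comb (theta - b).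

Definition dual_basis (omega : 'I_n -> V) : Prop :=
  forall i j, dot (omega i) (alpha j) = (i == j)%:R.

End Basis.

(* The vector x + c delta is represented by the pair (x, c). *)
Definition affine_space : lmodType R := (V * R^o)%type.

Definition affine_dot (x y : affine_space) : R := dot x.1 y.1.

Definition affine_roots (Phi : set V) : set affine_space :=
  [set x | Phi x.1 /\ exists k : int, x.2 = k%:~R].

Definition affine_simple_roots (n : nat) (alpha : 'I_n -> V) (theta : V) :
    set affine_space :=
  [set (alpha i, 0) | i in [set: 'I_n]] `|` [set (- theta, 1)].

Definition parabolic_subsystem (Phi : set V) (Gamma : set affine_space) :
    set affine_space :=
  generated_subsystem affine_dot (affine_roots Phi) Gamma.

Definition root_polytope (Phi : set V) : set V :=
  smallest (@convex_set R V) Phi.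

Definition weyl_half_spaces (n : nat) (Phi : set V) (omega : 'I_n -> V)
    (m : 'I_n -> R) (J : set 'I_n) : set (set V) :=
  [set H | exists w i, [/\ weyl_group Phi w, J i &
     H = [set x | dot x (w (omega i)) <= m i]]].

End RootSystem.

Definition half_space_representation (T : Type) (P : set T) (F : set (set T)) :
    Prop :=
  \bigcap_(H in F) H = P.

Definition minimal_representation (T : Type) (P : set T) (F : set (set T)) :
    Prop :=
  half_space_representation P F /\
  forall G : set (set T), G `<` F -> ~ half_space_representation P G.

(* Main.v *)
(* For [y] in the dominant chamber, [theta - x] in the cone of the simple roots
   gives [(x,y) <= (theta,y)]; moving a separating functional of a point into
   the dominant chamber thus yields the first half-space representation.
   If removing [alpha_i] from the extended diagram splits off a set [B] of
   simple roots not linked to the affine node, then for [j] in [B] the vector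
   [omega_j / m_j - omega_i / m_i] lies in the cone of [B], so on dominant
   points the inequality of [j] implies that of [i].  If the diagram stays
   connected, the roots with [(b, omega_i) = m_i] span the whole space: they
   form a genuine facet, and a point just beyond its barycentre violates only
   that inequality. *)

Require Import Defs.
From HB Require Import structures.
From mathcomp Require Import all_boot all_order all_algebra sesquilinear.
From mathcomp Require Import mathcomp_extra boolp classical_sets functions.
From mathcomp Require Import cardinality reals convex.
From mathcomp Require Import interval_inference ring lra.

Set Implicit Arguments.
Unset Strict Implicit.
Unset Printing Implicit Defensive.

Import Order.TTheory GRing.Theory Num.Theory.

Local Open Scope classical_set_scope.
Local Open Scope ring_scope.

(** * Farkas' lemma for finitely many linear forms *)

Lemma lift_max_widen m (i : 'I_m) : lift ord_max i = widen_ord (leqnSn m) i.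
Proof. exact/val_inj/lift_max. Qed.

Section FarkasLemma.
Context {R : realFieldType} {E : lmodType R}.

Lemma farkas (m : nat) (a : 'I_m -> E -> R) (g : E -> R) :
  (forall i, scalar (a i)) -> scalar g ->
  (forall x, (forall i, a i x <= 0) -> g x <= 0) ->
  exists2 l : 'I_m -> R, forall i, 0 <= l i &
    forall x, g x = \sum_i l i * a i x.
Proof.
elim: m a g => [|m IH] a g alin glin hg.
  (* Without constraints, [g] is nonpositive at both [x] and [- x], hence zero. *)
  exists (fun=> 0) => // x; rewrite big_ord0; apply/eqP.
  have gN : g (- x) = - g x.
    have g0 : g 0 = 0.
      by have := glin 1 0 0; rewrite scaler0 addr0 mul1r => ?; lra.
    by have := glin (-1) x 0; rewrite g0 !addr0 scaleN1r mulN1r.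
  by rewrite eq_le -[0 <= _]oppr_le0 -gN !hg// => -[[]].
pose a' i := a (widen_ord (leqnSn m) i); pose b := a ord_max.
have [|/existsNP[x0 /not_implyP[x0a /negP]]] :=
    pselect (forall x, (forall i, a' i x <= 0) -> g x <= 0).
  move=> /IH[|//|l l0 gE]; first by move=> i; exact: alin.
  exists (fun i => if unlift ord_max i is Some j then l j else 0).
    by move=> i; case: unliftP.
  move=> x; rewrite big_ord_recr /= unlift_none mul0r addr0 gE.
  apply: eq_bigr => i _.
  by rewrite -lift_max_widen liftK /a' lift_max_widen.
rewrite -ltNge => gx0.
have bx0 : 0 < b x0.
  rewrite ltNge; apply/negP => bx0; suff : g x0 <= 0 by lra.
  apply: hg => i; have [->//|] := eqVneq i ord_max.
  rewrite eq_sym => /unlift_some[j -> _].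
  by rewrite lift_max_widen; exact: x0a.
have blin : scalar b by exact: alin.
(* Bartl's elimination step: shift along [x0] into the kernel of [b]. *)
have [||x hx|l l0 gE] :=
  IH (fun i x => a' i x - a' i x0 / b x0 * b x)
     (fun x => g x - g x0 / b x0 * b x).
- by move=> i k u v /=; rewrite blin /a' alin; ring.
- by move=> k u v /=; rewrite blin glin; ring.
- pose x' := - (b x / b x0) *: x0 + x.
  have <- : g x' = g x - g x0 / b x0 * b x.
    by rewrite glin mulNr addrC; congr (_ - _); field; rewrite gt_eqF.
  apply: hg => i; have [->|] := eqVneq i ord_max.
    rewrite -/b blin; suff -> : - (b x / b x0) * b x0 + b x = 0 by [].
    by field; rewrite gt_eqF.
  rewrite eq_sym => /unlift_some[j -> _].
  rewrite lift_max_widen; have := hx j; rewrite alin -/(a' j); suff -> :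
    - (b x / b x0) * a' j x0 + a' j x = a' j x - a' j x0 / b x0 * b x by [].
  by field; rewrite gt_eqF.
(* The last coefficient collects the multiples of [b] in the reduced identity; it is nonnegative
   because [g x0 > 0] and every [a' j x0 <= 0]. *)
- exists (fun i => if unlift ord_max i is Some j then l j
    else (g x0 - \sum_j l j * a' j x0) / b x0).
    move=> i; case: unliftP => // _; apply: divr_ge0; last exact: ltW.
    rewrite subr_ge0 (le_trans _ (ltW gx0))// sumr_le0// => j _.
    by rewrite mulr_ge0_le0.
  move=> x; rewrite big_ord_recr /= unlift_none -/b.
  have /= /(canRL (subrK _)) -> := gE x.
  have -> : \sum_i l i * (a' i x - a' i x0 / b x0 * b x) =
      \sum_i l i * a' i x - (\sum_i l i * a' i x0) / b x0 * b x.
    by rewrite 2!mulr_suml -sumrB; apply: eq_bigr => i _; ring.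
  under [X in _ = X + _]eq_bigr => i _.
    rewrite -lift_max_widen liftK lift_max_widen.
    over.
  ring.
Qed.

End FarkasLemma.

(** * Convex sets and finite convex combinations *)

Section Convexity.
Context {R : realType} {V : lmodType R}.

(** Trades the interval-typed weight of [convex_set] for a real number with explicit bounds. *)
Lemma convex_setP (A : set V) : convex_set A <->
  forall x y (t : R), 0 <= t <= 1 -> A x -> A y -> A (t *: x + (1 - t) *: y).
Proof.
split=> [cA x y t /andP[t0 t1] Ax Ay|cA x y t /set_mem Ax /set_mem Ay].
  have t01 : Itv.spec (@Itv.num_sem _) (Itv.Real `[0%Z, 1%Z]%R) t.
    rewrite /= /Itv.num_sem/= num_real/= in_itv/=.
    by rewrite t0 t1.
  have /set_mem := cA x y (Itv.mk t01) (mem_set Ax) (mem_set Ay).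
  by [].
by apply/mem_set/cA => //; rewrite ge0 le1.
Qed.

Lemma convex_comb_mem (A : set V) m (v : 'I_m -> V) (l : 'I_m -> R) :
  convex_set A -> (forall i, A (v i)) -> (forall i, 0 <= l i) ->
  \sum_i l i = 1 -> A (\sum_i l i *: v i).
Proof.
move=> /convex_setP cA Av l0 l1.
(* The first weights alone need not sum to 1, so the induction allows any total, and does not ask
   for [x] in [A] when the total is 0. *)
have : exists2 x, \sum_i l i = 0 \/ A x &
    \sum_i l i *: v i = (\sum_i l i) *: x.
  elim: m v l Av l0 {l1} => [|m IH] v l Av l0.
    by exists 0; [left|]; rewrite !big_ord0// scaler0.
  rewrite !big_ord_recr/=.
  have [|i|x] := IH (fun i => v (widen_ord (leqnSn m) i))
    (fun i => l (widen_ord (leqnSn m) i)) => //.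
  set s := \sum_(i < m) _; set c := l ord_max => hx ->.
  have s0 : 0 <= s by apply: sumr_ge0.
  have c0 : 0 <= c by exact: l0.
  case: (eqVneq s 0) => [->|sN0].
    by exists (v ord_max); [right|rewrite scale0r !add0r].
  case: hx => [/eqP|Ax]; first by rewrite (negbTE sN0).
  have s_gt0 : 0 < s by rewrite lt0r sN0.
  exists (s / (s + c) *: x + (1 - s / (s + c)) *: v ord_max).
    right; apply: cA => //; rewrite divr_ge0 ?addr_ge0//=.
    by rewrite ler_pdivrMr; lra.
  rewrite scalerDr !scalerA; congr (_ *: _ + _ *: _); field; lra.
by move=> [x]; rewrite l1 scale1r => -[/eqP|Ax ->//]; rewrite oner_eq0.
Qed.

End Convexity.

(** * Reflections for a symmetric, possibly degenerate, bilinear form *)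

Section ReflectionGroups.
Context {R : realType} {E : lmodType R}.
Variable f : E -> E -> R.
Hypotheses (fC : forall x y, f x y = f y x) (flin : forall y, scalar (f^~ y)).

Definition lin_span (G : set E) : set E :=
  smallest (fun T : set E => T 0 /\
    forall k u v, T u -> T v -> T (k *: u + v)) G.

Lemma lin_span_closed (G : set E) k u v :
  lin_span G u -> lin_span G v -> lin_span G (k *: u + v).
Proof.
move=> Gu Gv T hT; have [[_ TD] _] := hT.
by apply: TD; [exact: Gu|exact: Gv].
Qed.

Lemma bilin0l x : f 0 x = 0.
Proof. by have := flin x 1 0 0; rewrite scaler0 addr0 mul1r => ?; lra. Qed.

Lemma bilinZl k x y : f (k *: x) y = k * f x y.
Proof. by have := flin y k x 0; rewrite bilin0l !addr0. Qed.

Lemma bilinDl x y z : f (x + y) z = f x z + f y z.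
Proof. by have := flin z 1 x y; rewrite scale1r mul1r. Qed.

Lemma bilinZr k x y : f x (k *: y) = k * f x y.
Proof. by rewrite fC bilinZl fC. Qed.

Lemma bilinDr x y z : f x (y + z) = f x y + f x z.
Proof. by rewrite fC bilinDl !(fC x). Qed.

Lemma sub_lin_span (G : set E) : G `<=` lin_span G.
Proof. by move=> g Gg T [_]; apply. Qed.

Lemma lin_span_orthogonal1 (G : set E) y :
  (forall g, G g -> f g y = 0) -> forall x, lin_span G x -> f x y = 0.
Proof.
move=> Gy; apply: (smallest_sub (X := [set x | f x y = 0])) => //=.
split=> /= [|k u v]; first by rewrite bilin0l.
by rewrite flin => -> ->; rewrite mulr0 addr0.
Qed.

Lemma lin_span_orthogonal (G H : set E) :
  (forall g h, G g -> H h -> f g h = 0) ->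
  forall x y, lin_span G x -> lin_span H y -> f x y = 0.
Proof.
move=> GH x y Gx Hy; apply: lin_span_orthogonal1 Gx => g Gg.
by rewrite fC; apply: lin_span_orthogonal1 Hy => h Hh; rewrite fC GH.
Qed.

(** The generated system lies in the span of [G], so an orthogonal splitting of [G] splits it by
    spans. Conversely a splitting of the system cuts [G] into two parts, both nonempty because an
    anisotropic vector of the span cannot be orthogonal to all of [G]. *)
Lemma irreducible_generated (Psi G : set E) :
  refl_stable f Psi -> (forall x, Psi x -> f x x != 0) -> G `<=` Psi ->
  irreducible_roots f (generated_subsystem f Psi G) <-> irreducible_roots f G.
Proof.
move=> Psi_stable anis GPsi; set S := generated_subsystem f Psi G.
have GS : G `<=` S by move=> g Gg T [_]; apply.
(* Induction principle for [S]: the competitor for [smallest] must lie in [Psi], hence the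
   intersection with [U]. *)
have S_sub (U : set E) :
    (forall a b, U a -> Psi a -> U b -> Psi b -> U (refl f a b)) ->
    G `<=` U -> S `<=` U.
  move=> U_stable GU; suff : S `<=` Psi `&` U by move=> h x /h[].
  apply: smallest_sub => [|g Gg]; last by split; [exact: GPsi|exact: GU].
  split=> [x []//|a b [Pa Ua] [Pb Ub]]; split; first exact: Psi_stable.
  exact: U_stable.
have refl_span (U : set E) a b : lin_span U a -> lin_span U b ->
    lin_span U (refl f a b).
  by move=> *; rewrite /refl addrC -scaleNr; apply: lin_span_closed.
have Sspan : S `<=` lin_span G.
  by apply: S_sub (@sub_lin_span G) => a b *; exact: refl_span.
have notorth x : S x -> ~ (forall g, G g -> f g x = 0).
  move=> Sx /lin_span_orthogonal1/(_ x (Sspan x Sx))/eqP; apply/negP/anis.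
  by move: x Sx; apply: smallest_sub => //; split.
split=> -[[x0 Sx0] irr]; split.
- apply: contrapT => G0; apply: (notorth _ Sx0) => g Gg.
  by exfalso; apply: G0; exists g.
- move=> [A [B [[a Aa] [b Bb] GE AB]]]; apply: irr.
  have orth := lin_span_orthogonal AB.
  exists (S `&` lin_span A), (S `&` lin_span B); split.
  + by exists a; split; [apply: GS; rewrite GE; left|exact: sub_lin_span].
  + by exists b; split; [apply: GS; rewrite GE; right|exact: sub_lin_span].
  + rewrite -setIUr; apply/esym/setIidPl; apply: S_sub; last first.
      by rewrite GE => g [?|?]; [left|right]; exact: sub_lin_span.
    (* [d] keeps its side: a reflection in a vector of its own span stays in that span, and one in a
       vector of the other span fixes [d]. *)
    move=> c d [Ac|Bc] _ [Ad|Bd] _; [left|right|left|right].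
    * exact: refl_span.
    * by rewrite /refl fC orth// mulr0 mul0r scale0r subr0.
    * by rewrite /refl orth// mulr0 mul0r scale0r subr0.
    * exact: refl_span.
  + by move=> x y [_ Ax] [_ By]; exact: orth.
- by exists x0; exact: GS.
- move=> [A [B [A0 B0 SE AB]]]; apply: irr.
  have GAB g : G g -> A g \/ B g by move=> /GS; rewrite SE.
  exists (G `&` A), (G `&` B); split=> //.
  + have [a Aa] := A0; apply: contrapT => GA0.
    apply: (notorth a); first by rewrite SE; left.
    move=> g Gg; case: (GAB g Gg) => Hg; last by rewrite fC AB.
    by exfalso; apply: GA0; exists g.
  + have [b Bb] := B0; apply: contrapT => GB0.
    apply: (notorth b); first by rewrite SE; right.
    move=> g Gg; case: (GAB g Gg) => Hg; first exact: AB.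
    by exfalso; apply: GB0; exists g.
  + by rewrite -setIUr -SE; apply/esym/setIidPl.
  + by move=> a b [_ Aa] [_ Bb]; exact: AB.
Qed.

Context (S : set E) (S_anis : forall a, S a -> f a a != 0).

Lemma refl_isometry a x y : S a -> f (refl f a x) (refl f a y) = f x y.
Proof.
move=> /S_anis a0; rewrite /refl -!scaleNr !(bilinDl, bilinZl).
rewrite !(bilinDr, bilinZr) (fC a y).
by field.
Qed.

Lemma reflK a : S a -> involutive (refl f a).
Proof.
move=> /S_anis a0 x; rewrite /refl -!scaleNr !(bilinDl, bilinZl).
rewrite -addrA -scalerDl -[RHS]addr0 -[0 in RHS](scale0r a).
by congr (_ + _ *: _); field.
Qed.

Lemma refl_group_comp u w :
  refl_group f S u -> refl_group f S w -> refl_group f S (u \o w).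
Proof.
move=> Su Sw; elim: Su => [//|a v Sa _ IH].
exact: (refl_groupM Sa IH).
Qed.

Lemma refl_group_isometry w :
  refl_group f S w -> forall x y, f (w x) (w y) = f x y.
Proof. by elim=> [//|a v Sa _ IH] x y; rewrite /= refl_isometry. Qed.

Lemma refl_group_stable w : refl_stable f S -> refl_group f S w ->
  forall x, S x -> S (w x).
Proof. by move=> Sst; elim=> [//|a v Sa _ IH] x /IH; exact: Sst. Qed.

Lemma refl_group_inv w : refl_group f S w ->
  exists w', [/\ refl_group f S w', cancel w w' & cancel w' w].
Proof.
elim=> [|a v Sa _ [v' [Sv' vK v'K]]].
  by exists id; split=> //; exact: refl_group1.
exists (v' \o refl f a); split.
- apply: refl_group_comp => //; exact: (refl_groupM Sa (refl_group1 f S)).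
- by move=> x /=; rewrite reflK// vK.
- by move=> x /=; rewrite v'K reflK.
Qed.

End ReflectionGroups.

(** * The Euclidean scalar product *)

Section RootPolytope.
Context {R : realType} {V : vectType R}.
Variable dot : {dot V for (idfun : R -> R)}.

Lemma dotC x y : dot x y = dot y x.
Proof. by have := @hermitian_subproof _ _ _ _ dot x y; rewrite mul1r. Qed.

Lemma dot_scalar y : scalar (dot^~ y).
Proof. by move=> k u v; exact: linearPl. Qed.

Let dotZl := bilinZl dot_scalar.
Let dotDl := bilinDl dot_scalar.
Let dotDr := bilinDr dotC dot_scalar.
Let dotZr := bilinZr dotC dot_scalar.
Let dot0l := bilin0l dot_scalar.

Lemma dotNl x y : dot (- x) y = - dot x y.
Proof. by rewrite -scaleN1r dotZl mulN1r. Qed.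

Lemma dotBl x y z : dot (x - y) z = dot x z - dot y z.
Proof. by rewrite dotDl dotNl. Qed.

Lemma dot0r x : dot x 0 = 0. Proof. by rewrite dotC dot0l. Qed.

Lemma dot_suml I (r : seq I) P (F : I -> V) z :
  dot (\sum_(i <- r | P i) F i) z = \sum_(i <- r | P i) dot (F i) z.
Proof. exact: linear_sumlz. Qed.

Lemma dot_sumr I (r : seq I) P (F : I -> V) z :
  dot z (\sum_(i <- r | P i) F i) = \sum_(i <- r | P i) dot z (F i).
Proof. exact: linear_sumr. Qed.

Lemma dot_eq0 x : (dot x x == 0) = (x == 0).
Proof.
have [->|x0] := eqVneq x 0; first by rewrite dot0l eqxx.
by rewrite gt_eqF// neq0_dnorm_gt0.
Qed.

Lemma dot_ge0 x : 0 <= dot x x.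
Proof.
by have [->|/neq0_dnorm_gt0/ltW] := eqVneq x 0; rewrite ?dot0l.
Qed.

(** * Roots in coordinates with respect to the simple roots *)

Section Data.
Context (n : nat) (Phi : set V) (alpha : 'I_n -> V) (theta : V) (m : 'I_n -> R)
  (omega : 'I_n -> V).
Hypotheses (hPhi : reduced_root_system dot Phi) (hbasis : root_basis Phi alpha)
  (htheta : highest_root Phi alpha theta)
  (hm : theta = \sum_i m i *: alpha i) (homega : dual_basis dot alpha omega).
Local Notation W := (weyl_group dot Phi).

Lemma dot_alpha_omega i j : dot (alpha i) (omega j) = (i == j)%:R.
Proof. by rewrite dotC homega eq_sym. Qed.

Lemma dot_sum_alpha (c : 'I_n -> R) i :
  dot (\sum_j c j *: alpha j) (omega i) = c i.
Proof.
rewrite dot_suml (bigD1 i)//= big1 => [|j ji].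
  by rewrite dotZl dot_alpha_omega eqxx mulr1 addr0.
by rewrite dotZl dot_alpha_omega (negbTE ji) mulr0.
Qed.

(** The dual basis reads off coordinates, so only the existence of an expansion comes from
    [basis_of]; the casts match positions in the sequence of simple roots with ['I_n]. *)
Lemma alpha_expansion x : x = \sum_i dot x (omega i) *: alpha i.
Proof.
suff [c xE] : exists c : 'I_n -> R, x = \sum_i c i *: alpha i.
  by rewrite {1}xE; apply: eq_bigr => i _; rewrite xE dot_sum_alpha.
have [_ /andP[/eqP spanE _] _] := hbasis.
have : x \in fullv by rewrite memvf.
rewrite -spanE => /(@coord_span _ _ _ (in_tuple _)) ->.
set X := in_tuple _.
have Xn : size [seq alpha i | i : 'I_n] = n by rewrite size_map size_enum_ord.
exists (fun i => coord X (cast_ord (esym Xn) i) x).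
rewrite (reindex (cast_ord Xn))/=; last first.
  by exists (cast_ord (esym Xn)) => i _; rewrite ?cast_ordK ?cast_ordKV.
apply: eq_bigr => i _; rewrite cast_ordK; congr (_ *: _).
rewrite (nth_map (cast_ord Xn i)) ?size_enum_ord; last first.
  by rewrite -[X in (_ < X)%N]Xn.
by congr alpha; apply/val_inj; rewrite /= nth_enum_ord// -[X in (_ < X)%N]Xn.
Qed.

Lemma dot_expansion x y :
  dot x y = \sum_i dot x (omega i) * dot (alpha i) y.
Proof.
rewrite {1}(alpha_expansion x) dot_suml.
by apply: eq_bigr => i _; rewrite dotZl.
Qed.

Lemma omega_nondegenerate x : (forall i, dot x (omega i) = 0) -> x = 0.
Proof.
by move=> x0; rewrite (alpha_expansion x) big1// => i _; rewrite x0 scale0r.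
Qed.

Lemma alpha_nondegenerate x : (forall i, dot (alpha i) x = 0) -> x = 0.
Proof.
move=> x0; apply/eqP; rewrite -dot_eq0 dot_expansion big1// => i _.
by rewrite x0 mulr0.
Qed.

Lemma root_anisotropic a : Phi a -> dot a a != 0.
Proof.
move=> Pa; rewrite dot_eq0; apply/eqP => a0.
by apply: (root_neq0 hPhi); rewrite -a0.
Qed.

Lemma pos_comb_omega x : pos_comb alpha x ->
  forall i, exists k : nat, dot x (omega i) = k%:R.
Proof.
move=> [c ->] i; exists (c i).
under eq_bigr do rewrite -scaler_nat.
by rewrite dot_sum_alpha.
Qed.

Lemma dot_theta_omega i : dot theta (omega i) = m i.
Proof. by rewrite hm dot_sum_alpha. Qed.

(** The gap is kept as a natural number: a nonzero gap is then at least 1, which quantifies how far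
    a root lies from a facet. *)
Lemma root_le_theta b i :
  Phi b -> exists k : nat, dot b (omega i) = m i - k%:R.
Proof.
move=> /(proj2 htheta)/pos_comb_omega/(_ i)[k]; rewrite dotBl dot_theta_omega.
by move=> kE; exists k; rewrite -kE subKr.
Qed.

Lemma m_ge1 i : 1 <= m i.
Proof.
have [k] := root_le_theta i (root_basis_root hbasis i).
rewrite dot_alpha_omega eqxx /= => kE; have := ler0n R k; lra.
Qed.

Lemma m_gt0 i : 0 < m i. Proof. exact: lt_le_trans (m_ge1 i). Qed.

(** Reflecting [alpha j] in [alpha i] gives a root with coefficient 1 on [alpha j]. It is therefore
    positive, so its coefficient [- c] on [alpha i] is nonnegative. *)
Lemma alpha_obtuse i j : i != j -> dot (alpha i) (alpha j) <= 0.
Proof.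
move=> ij; have Pa := root_basis_root hbasis; have [_ _ sgn] := hbasis.
have ai0 : 0 < dot (alpha i) (alpha i).
  by rewrite lt0r root_anisotropic// dot_ge0.
have := root_refl hPhi (Pa i) (Pa j); rewrite /refl.
set c := 2 * _ / _ => Pr.
have [/pos_comb_omega/(_ i)[k]|/pos_comb_omega/(_ j)[k]] := sgn _ Pr;
    last first.
  rewrite dotNl dotBl dotZl !dot_alpha_omega eqxx (negbTE ij) mulr0 subr0.
  by move=> kE; have := ler0n R k; rewrite -kE /=; lra.
rewrite dotBl dotZl !dot_alpha_omega eqxx eq_sym (negbTE ij) /= mulr1 => cE.
have : c <= 0 by have := ler0n R k; rewrite -cE; lra.
by rewrite /c pmulr_lle0 ?invr_gt0// dotC; lra.
Qed.

(** * The Weyl group and the dominant chamber *)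

Lemma weyl_inv w : W w -> exists w', [/\ W w', cancel w w', cancel w' w &
  forall x y, dot (w x) y = dot x (w' y)].
Proof.
move=> Ww; have [w' [Ww' wK w'K]] :=
  refl_group_inv dot_scalar root_anisotropic Ww.
exists w'; split=> // x y; rewrite -{1}(w'K y).
exact: (refl_group_isometry dotC dot_scalar root_anisotropic Ww).
Qed.

Lemma weyl_root w b : W w -> Phi b -> Phi (w b).
Proof. by move=> Ww; exact: (refl_group_stable (root_refl hPhi) Ww). Qed.

Definition dominant (y : V) := forall i, 0 <= dot (alpha i) y.

Lemma dominant_dot x y :
  (forall i, 0 <= dot x (omega i)) -> dominant y -> 0 <= dot x y.
Proof.
move=> x0 y0; rewrite dot_expansion.
by apply: sumr_ge0 => i _; rewrite mulr_ge0.
Qed.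

Lemma dominant_omega i : dominant (omega i).
Proof. by move=> j; rewrite dot_alpha_omega. Qed.

(** The dual Weyl vector (sum of the fundamental coweights), used as a strictly dominant test
    vector. *)
Definition rho := \sum_i omega i.

Lemma dot_alpha_rho i : dot (alpha i) rho = 1.
Proof.
rewrite dot_sumr (bigD1 i)//= big1 => [|j ji].
  by rewrite dot_alpha_omega eqxx addr0.
by rewrite dot_alpha_omega eq_sym (negbTE ji).
Qed.

(* Maximise [dot (w x) rho]; only finitely many values occur, since they are
   determined by the roots [w^-1 (alpha j)]. *)
Lemma dominant_conjugate x : exists w, [/\ W w, dominant (w x) &
  forall z, dominant z -> dot x z <= dot (w x) z].
Proof.
have [s PhiE] := (finite_seqP _).1 (root_finite hPhi).
have Ps b : Phi b -> b \in s by rewrite PhiE.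
(* [g j] stands for the root [w^-1 (alpha j)], so the maximum is taken over a finite type; [F g] is
   [dot (w x) rho] expanded in the simple roots. *)
pose good (g : {ffun 'I_n -> seq_sub s}) w := [/\ W w,
  (forall z, dominant z -> dot x z <= dot (w x) z) &
  (forall j, dot x (ssval (g j)) = dot (w x) (alpha j))].
pose P g := `[< exists w, good g w >].
pose F (g : {ffun 'I_n -> seq_sub s}) :=
  \sum_j dot rho (omega j) * dot x (ssval (g j)).
have FE g w : good g w -> F g = dot (w x) rho.
  move=> [_ _ gE]; rewrite dotC dot_expansion; apply: eq_bigr => j _.
  by rewrite gE [dot (alpha j) _]dotC.
have goodP w : W w -> (forall z, dominant z -> dot x z <= dot (w x) z) ->
    exists g, good g w.
  move=> Ww wx; have [w' [Ww' _ _ adj]] := weyl_inv Ww.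
  have w's j : w' (alpha j) \in s.
    exact/Ps/(weyl_root Ww')/(root_basis_root hbasis).
  by exists [ffun j => SeqSub (w's j)]; split=> // j; rewrite ffunE/= adj.
have [g0 g0P] : exists g, good g id by apply: goodP => //; exact: refl_group1.
have Pg0 : P g0 by apply/asboolP; exists id.
case: (arg_maxP F Pg0) => g /asboolP[w gw] gmax; exists w.
have [Ww wx _] := gw; split=> // i; rewrite leNgt; apply/negP => neg.
have Pa := root_basis_root hbasis i.
have ai0 : 0 < dot (alpha i) (alpha i).
  by rewrite lt0r root_anisotropic// dot_ge0.
(* This reflection adds [- c *: alpha i] with [c < 0]: pairings with dominant vectors do not
   decrease, and the one with [rho] strictly increases. *)
pose w1 := refl dot (alpha i) \o w.
pose c := 2 * dot (w x) (alpha i) / dot (alpha i) (alpha i).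
have c0 : c < 0 by rewrite /c pmulr_llt0 ?invr_gt0// dotC; lra.
have w1E z : dot (w1 x) z = dot (w x) z - c * dot (alpha i) z.
  by rewrite /w1/= /refl dotBl dotZl.
have [||g1 g1P] := goodP w1.
- exact: refl_groupM.
- move=> z z0; rewrite w1E (le_trans (wx z z0))// lerDl oppr_ge0.
  by rewrite mulr_le0_ge0// ltW.
have := gmax g1; rewrite (FE _ _ g1P) (FE _ _ gw) w1E dot_alpha_rho.
have -> : P g1 by apply/asboolP; exists w1.
by move=> /(_ isT) /=; lra.
Qed.

(** * Separation, and the representation by all half-spaces *)

Lemma root_polytope_separation x : ~ root_polytope Phi x ->
  exists y, forall b, Phi b -> dot b y < dot x y.
Proof.
have [s PhiE] := (finite_seqP _).1 (root_finite hPhi).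
have sP b : b \in s -> Phi b by rewrite PhiE.
(* A pair [(y, t)] encodes the affine function [dot b y + t]. Farkas on these pairs gives the
   weights: evaluating at [(0, 1)] shows that they sum to 1. *)
move=> xP; pose E : lmodType R := (V * R^o)%type.
pose a (b : V) (u : E) : R := dot b u.1 + u.2.
have alin b : scalar (a b).
  by move=> k u v; rewrite /a /= dotDr dotZr /GRing.scale/=; ring.
have [|/existsNP[[y t] /not_implyP[yb]]] := pselect (forall u : E,
    (forall i : 'I_(size s), a (tnth (in_tuple s) i) u <= 0) -> a x u <= 0).
  move=> /farkas[//|//|l l0 lE]; exfalso; apply: xP => A [cA PA].
  have l1 : \sum_i l i = 1.
    have := lE (0, 1); rewrite /a /= dot0r add0r => ->.
    by apply: eq_bigr => i _; rewrite dot0r add0r mulr1.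
  suff -> : x = \sum_i l i *: tnth (in_tuple s) i.
    apply: convex_comb_mem => // i; apply: PA; apply: sP.
    exact: mem_tnth.
  apply/eqP; rewrite -subr_eq0 -dot_eq0; set z := x - _.
  rewrite {1}/z dotBl subr_eq0; apply/eqP; have := lE (z, 0).
  rewrite /a /= addr0 => ->; rewrite dot_suml; apply: eq_bigr => i _.
  by rewrite addr0 dotZl.
move=> /negP; rewrite -ltNge /a /= => xyt; exists y => b; rewrite PhiE /= => bs.
have bi : (index b s < size s)%N by rewrite index_mem.
have := yb (Ordinal bi); rewrite /a /= (tnth_nth 0) /= nth_index//; lra.
Qed.

Definition weyl_le (J : set 'I_n) (x : V) :=
  forall w i, W w -> J i -> dot x (w (omega i)) <= m i.

Lemma bigcap_weyl_half_spaces (J : set 'I_n) :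
  \bigcap_(H in weyl_half_spaces dot Phi omega m J) H = weyl_le J.
Proof.
apply/seteqP; split=> x xJ; last by move=> H [w [i [Ww Ji ->]]]; exact: xJ.
move=> w i Ww Ji; apply: (xJ [set x | dot x (w (omega i)) <= m i]).
by exists w, i.
Qed.

Lemma weyl_le_weyl (J : set 'I_n) x w : weyl_le J x -> W w -> weyl_le J (w x).
Proof.
move=> xJ /weyl_inv[w' [Ww' _ _ adj]] u i Wu Ji.
by rewrite adj; apply: (xJ (w' \o u)) => //; exact: refl_group_comp.
Qed.

(** Half-spaces are convex, so only roots matter; moving [w] across the scalar product leaves a
    comparison with [theta]. *)
Lemma root_polytope_le J : root_polytope Phi `<=` weyl_le J.
Proof.
apply: smallest_sub => [|b Pb w i Ww _].
  apply/convex_setP => x y t /andP[t0 t1] xJ yJ w i Ww Ji.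
  rewrite dotDl !dotZl; have := xJ w i Ww Ji; have := yJ w i Ww Ji.
  set p := dot _ _; set q := dot _ _ => pm qm.
  have -> : m i = t * m i + (1 - t) * m i by ring.
  by rewrite lerD// ler_wpM2l// subr_ge0.
have [w' [Ww' _ _ adj]] := weyl_inv Ww.
rewrite dotC adj dotC.
by have [k ->] := root_le_theta i (weyl_root Ww' Pb); rewrite gerBl.
Qed.

(** If [y] separates [x] from the roots and [w y] is dominant, the root [w^-1 theta] still pairs
    with [y] at least as much as [x] does. *)
Lemma weyl_le_root_polytope : weyl_le setT `<=` root_polytope Phi.
Proof.
move=> x xT; apply: contrapT => /root_polytope_separation[y ylt].
have [w [Ww wy _]] := dominant_conjugate y.
have [w' [Ww' _ w'K adj]] := weyl_inv Ww.
have := ylt _ (weyl_root Ww' (proj1 htheta)).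
have -> z : dot z y = dot (w z) (w y).
  by rewrite (refl_group_isometry dotC dot_scalar root_anisotropic Ww).
have -> z : dot z y = dot (w z) (w y).
  by rewrite (refl_group_isometry dotC dot_scalar root_anisotropic Ww).
rewrite w'K ltNge => /negP; apply; rewrite -subr_ge0 -dotBl.
apply: dominant_dot => // i; rewrite dotBl dot_theta_omega subr_ge0.
exact: (weyl_le_weyl xT Ww (refl_group1 _ _)).
Qed.

(** * The affine root system and the extended diagram *)

Let affine_dotC (x y : @affine_space R V) :
  affine_dot dot x y = affine_dot dot y x.
Proof. exact: dotC. Qed.

Let affine_dot_scalar (y : @affine_space R V) : scalar ((affine_dot dot)^~ y).
Proof. by move=> k u v; rewrite /affine_dot /= dotDl dotZl. Qed.

Lemma root_opp b : Phi b -> Phi (- b).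
Proof.
move=> Pb; have := root_refl hPhi Pb Pb; rewrite /refl.
rewrite mulfK ?root_anisotropic//.
by rewrite -[X in X - _]scale1r -scalerBl (_ : 1 - 2 = -1) ?scaleN1r//; lra.
Qed.

(** Integrality of the Cartan numbers keeps the [delta] coordinate an integer. *)
Lemma affine_refl_stable : refl_stable (affine_dot dot) (affine_roots Phi).
Proof.
move=> a b [Pa [ka ak]] [Pb [kb bk]]; split; first exact: root_refl.
have [k kE] := root_int hPhi Pa Pb; exists (kb - k * ka).
rewrite /refl /affine_dot /= kE ak bk /GRing.scale /=.
by rewrite rmorphB rmorphM.
Qed.

Definition extended_diagram (i : 'I_n) :=
  affine_simple_roots alpha theta `\ (alpha i, 0).

Lemma extended_diagram_theta i : extended_diagram i (- theta, 1).
Proof.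
by split=> [|[_ /eqP]]; [right|rewrite oner_eq0].
Qed.

Lemma extended_diagram_alpha i j : j != i -> extended_diagram i (alpha j, 0).
Proof.
move=> ji; split=> [|[aE]]; first by left; exists j.
have := dot_alpha_omega j i; rewrite aE dot_alpha_omega eqxx (negbTE ji).
by move/eqP; rewrite oner_eq0.
Qed.

Lemma extended_diagramP i x : extended_diagram i x ->
  x = (- theta, 1) \/ exists2 j, j != i & x = (alpha j, 0).
Proof.
move=> [[[j _ <-]|->] ne]; [right|by left].
by exists j => //; apply/eqP => ji; apply: ne; rewrite ji.
Qed.

Lemma irreducible_parabolic i :
  irreducible_roots (affine_dot dot)
    (parabolic_subsystem dot Phi (extended_diagram i)) <->
  irreducible_roots (affine_dot dot) (extended_diagram i).
Proof.
apply: (irreducible_generated affine_dotC affine_dot_scalar).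
- exact: affine_refl_stable.
- by move=> x [Px _]; exact: root_anisotropic.
- move=> x /extended_diagramP[->|[j _ ->]]; split=> /=.
  + exact/root_opp/(proj1 htheta).
  + by exists 1.
  + exact: (root_basis_root hbasis).
  + by exists 0.
Qed.

(** * Redundant half-spaces *)

Lemma dot_theta y : dot theta y = \sum_i m i * dot (alpha i) y.
Proof. by rewrite hm dot_suml; apply: eq_bigr => i _; rewrite dotZl. Qed.

(* [u] vanishes on [theta] and on the simple roots outside [B], except
   [alpha i]; together with [B] these span, so [u] lies in the span of [B],
   on which the Gram matrix of an obtuse basis has nonnegative inverse. *)
Lemma orthogonal_component_cone (B : pred 'I_n) i j : ~~ B i -> B j ->
  (forall k, B k -> dot theta (alpha k) = 0) ->
  (forall k l, B k -> ~~ B l -> l != i -> dot (alpha k) (alpha l) = 0) ->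
  forall k, 0 <= dot (m i *: omega j - m j *: omega i) (omega k).
Proof.
move=> Bi Bj Btheta BA; set u := _ - _.
have ij : i != j by apply: contraNneq Bi => ->.
have dot_u y : dot u y = m i * dot (omega j) y - m j * dot (omega i) y.
  by rewrite dotBl !dotZl.
have utheta : dot theta u = 0.
  by rewrite dotC dot_u ![dot _ theta]dotC !dot_theta_omega mulrC subrr.
have ualpha k : dot (alpha k) u = m i * (j == k)%:R - m j * (i == k)%:R.
  by rewrite dotC dot_u !homega.
pose c k := dot u (omega k).
(* Coordinates of [u] after [theta] replaces [alpha i] in the basis: the coefficient of [theta] is
   [c i / m i], and [d i] vanishes. *)
pose d k := c k - c i / m i * m k.
pose a := c i / m i *: theta + \sum_(k | ~~ B k) d k *: alpha k.
pose b := \sum_(k | B k) d k *: alpha k.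
have uE : u = a + b.
  have dE : \sum_(k | ~~ B k) d k *: alpha k + b = \sum_k d k *: alpha k.
    by rewrite addrC [RHS](bigID B).
  rewrite /a -addrA dE hm scaler_sumr -big_split/=.
  rewrite {1}(alpha_expansion u); apply: eq_bigr => k _.
  by rewrite scalerA -scalerDl addrC subrK.
have di : d i = 0 by rewrite /d mulfVK ?subrr// gt_eqF// m_gt0.
have orth_a y : dot theta y = 0 ->
    (forall k, ~~ B k -> k != i -> dot (alpha k) y = 0) -> dot a y = 0.
  move=> y0 yB; rewrite dotDl dotZl y0 mulr0 add0r dot_suml big1// => k Bk.
  have [->|ki] := eqVneq k i; first by rewrite di scale0r dot0l.
  by rewrite dotZl yB// mulr0.
have au : dot a u = 0.
  apply: orth_a => // k Bk ki; rewrite ualpha.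
  rewrite [i == k]eq_sym (negbTE ki) mulr0 subr0.
  have /negbTE-> : j != k by apply: contraNneq Bk => <-.
  by rewrite mulr0.
have ab : dot a b = 0.
  apply: orth_a => [|l Bl li]; rewrite dot_sumr big1// => k Bk.
    by rewrite dotZr Btheta// mulr0.
  by rewrite dotZr dotC BA// mulr0.
(* [a] is orthogonal to both [u] and [b], hence to [a = u - b]. *)
have a0 : a = 0.
  by apply/eqP; rewrite -dot_eq0; move: au; rewrite uE dotDr ab addr0 => ->.
have cB k : ~~ B k -> c k = 0.
  move=> Bk; rewrite /c uE a0 add0r dot_suml big1// => l Bl.
  rewrite dotZl dot_alpha_omega (_ : (l == k) = false) ?mulr0//.
  by apply/negbTE; apply: contraNneq Bk => <-.
have ugeB k : B k -> 0 <= dot (alpha k) u.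
  move=> Bk; rewrite ualpha (_ : (i == k) = false); last first.
    by apply/negbTE; apply: contraNneq Bi => ->.
  by rewrite mulr0 subr0 mulr_ge0// ltW// m_gt0.
(* With [u = up - un], obtuseness gives [dot un up <= 0], while [dot un u >= 0] because [un] is
   supported in [B]; so [dot un un <= 0]. *)
pose un := \sum_(k | c k < 0) - c k *: alpha k.
pose up := \sum_(k | ~~ (c k < 0)) c k *: alpha k.
have un0 : un = 0.
  apply/eqP; rewrite -dot_eq0 eq_le dot_ge0 andbT.
  have uun : 0 <= dot un u.
    rewrite dot_suml; apply: sumr_ge0 => k ck; rewrite dotZl mulr_ge0//.
      by rewrite oppr_ge0 ltW.
    by apply: ugeB; apply: contraTT ck => /cB ->; rewrite ltxx.
  have upn : dot un up <= 0.
    rewrite dot_suml; apply: sumr_le0 => k ck; rewrite dotZl mulr_ge0_le0//.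
      by rewrite oppr_ge0 ltW.
    rewrite dot_sumr; apply: sumr_le0 => l cl; rewrite dotZr mulr_ge0_le0//.
      by rewrite leNgt.
    by apply: alpha_obtuse; apply: contraTneq ck => ->.
  have uE' : u = up - un.
    rewrite {1}(alpha_expansion u) (bigID (fun k => c k < 0))/= addrC.
    congr (_ + _); rewrite -sumrN.
    by apply: eq_bigr => k _; rewrite scaleNr opprK.
  by move: uun; rewrite uE' dotC dotBl dotC subr_ge0 => /le_trans; apply.
move=> k; rewrite leNgt; apply/negP => ck.
have := congr1 (dot^~ (omega k)) un0; rewrite dot0l /un.
rewrite (eq_bigr (fun l => if l == l then - c l *: alpha l else 0)); last first.
  by move=> l _; rewrite eqxx.
rewrite dot_suml (bigD1 k)//= big1 => [|l /andP[_ lk]]; last first.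
  by rewrite eqxx dotZl dot_alpha_omega (negbTE lk) mulr0.
by rewrite eqxx dotZl dot_alpha_omega eqxx -/(c k) /= in ck *; lra.
Qed.

(** Of the two orthogonal parts, the one without the affine node contains only simple roots, and
    their indices form [B]. Orthogonality to the affine node is orthogonality to [theta]. *)
Lemma reducible_component i :
  ~ irreducible_roots (affine_dot dot) (extended_diagram i) ->
  exists (B : pred 'I_n) j, [/\ ~~ B i, B j,
    forall k, B k -> dot theta (alpha k) = 0 &
    forall k l, B k -> ~~ B l -> l != i -> dot (alpha k) (alpha l) = 0].
Proof.
move=> nirr.
have {nirr} [A [B [B0 DE At AB]]] : exists A B : set (@affine_space R V),
    [/\ B !=set0, extended_diagram i = A `|` B, A (- theta, 1) &
     forall a b, A a -> B b -> affine_dot dot a b = 0].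
  apply: contrapT => h; apply: nirr; split.
    by exists (- theta, 1); exact: extended_diagram_theta.
  move=> [A [B [A0 B0 DE AB]]]; apply: h.
  have := extended_diagram_theta i; rewrite DE => -[At|Bt].
    by exists A, B.
  by exists B, A; split; rewrite 1?setUC// => a b Ba Ab; rewrite affine_dotC AB.
have nAB x : A x -> B x -> dot x.1 x.1 = 0 by move=> Ax Bx; exact: AB.
have D x : A x \/ B x -> extended_diagram i x by rewrite DE.
have Btheta k : B (alpha k, 0) -> dot theta (alpha k) = 0.
  move=> /(AB _ _ At); rewrite /affine_dot /= dotNl => /eqP.
  by rewrite oppr_eq0 => /eqP.
have [b Bb] := B0.
have [bE|[j ji bE]] := extended_diagramP (D _ (or_intror Bb)).
  move: Bb; rewrite bE => /(nAB _ At)/eqP/=.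
  by rewrite (negbTE (root_anisotropic (root_opp (proj1 htheta)))).
exists (fun k => `[< B (alpha k, 0) >]), j; split.
- apply/asboolP => Bi; have [_ ] := D _ (or_intror Bi); exact.
- by apply/asboolP; rewrite -bE.
- by move=> k /asboolP; exact: Btheta.
- move=> k l /asboolP Bk /asboolP nBl li; rewrite dotC.
  apply: (AB (alpha l, 0) (alpha k, 0)) => //.
  by have := extended_diagram_alpha li; rewrite DE => -[].
Qed.

Definition facet_index : set 'I_n := [set i | irreducible_roots (affine_dot dot)
  (parabolic_subsystem dot Phi (extended_diagram i))].

(* Maximise [dot y (omega j) / m j], breaking ties by [rho]: at a maximal [j]
   no component avoids the affine node, since it would give a larger index. *)
Lemma facet_index_dominates y i : dominant y ->
  exists2 j, facet_index j &
    dot y (omega i) / m i <= dot y (omega j) / m j.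
Proof.
move=> y0.
pose h z j := dot z (omega j) / m j.
case: (@arg_maxP _ _ _ i predT (h y) isT) => j1 _ j1max0.
have j1max l : h y l <= h y j1 by exact: j1max0.
case: (@arg_maxP _ _ _ j1 (fun j => h y j == h y j1) (h rho) (eqxx _)) => j.
move=> /eqP jE jmax; exists j; last by rewrite -/(h y i) -/(h y j) jE j1max.
apply/irreducible_parabolic; apply: contrapT => /reducible_component.
move=> [B [k [Bj Bk Bt BA]]].
have := orthogonal_component_cone Bj Bk Bt BA; set u := _ - _ => u0.
have dot_u z : dot u z = m j * m k * (h z k - h z j).
  rewrite dotBl !dotZl /h ![dot (omega _) z]dotC; field.
  by rewrite !gt_eqF ?m_gt0.
have mm : 0 < m j * m k by rewrite mulr_gt0 ?m_gt0.
have yk : h y k == h y j1.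
  rewrite eq_le -{2}jE (j1max) -subr_ge0 -(pmulr_rge0 _ mm) -dot_u.
  exact: dominant_dot.
have := jmax k yk => /=; rewrite -subr_le0 -(pmulr_rle0 _ mm) -dot_u => urho.
(* The tie-break bounds [dot u rho] above by 0, yet it is the sum of the nonnegative coordinates of
   [u]. So [u = 0], against its pairing [m j] with [alpha k]. *)
have u_rho : \sum_l dot u (omega l) = 0.
  apply/eqP; rewrite eq_le sumr_ge0// andbT; apply: le_trans urho.
  rewrite dot_expansion; apply: ler_sum => l _.
  by rewrite dot_alpha_rho mulr1.
have u_eq0 : u = 0.
  apply: omega_nondegenerate => l; move/eqP: u_rho.
  by rewrite psumr_eq0// => /allP/(_ l)/(_ (mem_index_enum _))/eqP.
have := congr1 (dot^~ (alpha k)) u_eq0; rewrite dot0l dotBl !dotZl !homega eqxx.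
have /negbTE-> : j != k by apply: contraNneq Bj => ->.
by have := m_gt0 j; rewrite /= mulr1 mulr0 subr0 => /gt_eqF/eqP.
Qed.

(** Moving [w^-1 x] into the dominant chamber only raises its pairing with [omega i], and there some
    facet inequality is at least as strong. *)
Lemma weyl_le_facet : weyl_le facet_index `<=` weyl_le setT.
Proof.
move=> x xF w i Ww _.
have [w' [Ww' _ w'K adj]] := weyl_inv Ww.
rewrite dotC adj dotC.
have [u [Wu ux le_ux]] := dominant_conjugate (w' x).
apply: le_trans (le_ux _ (dominant_omega i)) _.
have [j Fj] := facet_index_dominates i ux.
have : dot (u (w' x)) (omega j) / m j <= 1.
  rewrite ler_pdivrMr ?m_gt0// mul1r.
  exact: (weyl_le_weyl (weyl_le_weyl xF Ww') Wu (refl_group1 _ _)).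
move=> /[swap] /le_trans /[apply].
by rewrite ler_pdivrMr ?m_gt0// mul1r.
Qed.

(** * Genuine facets and irredundancy *)

Lemma dot_refl a x y :
  dot (refl dot a x) y = dot x y - 2 * dot x a / dot a a * dot a y.
Proof. by rewrite dotBl dotZl. Qed.

Lemma refl_adjoint a x y : dot (refl dot a x) y = dot x (refl dot a y).
Proof.
by rewrite [RHS]dotC !dot_refl (dotC y x) (dotC y a) (dotC a x); ring.
Qed.

(* The span [U] of the roots of the facet is written as a double orthogonal.
   It is stable under the reflections in [alpha k] for [k <> i], so it contains
   [alpha k] as soon as it contains a vector not orthogonal to [alpha k]:
   starting from [theta], connectedness brings in every [alpha k]. *)
Lemma facet_span i z : facet_index i ->
  (forall b, Phi b -> dot b (omega i) = m i -> dot b z = 0) -> z = 0.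
Proof.
move=> /irreducible_parabolic[_ irr].
pose perp z := forall b, Phi b -> dot b (omega i) = m i -> dot b z = 0.
rewrite -/(perp z) => zperp.
pose U v := forall z, perp z -> dot v z = 0.
have Utheta : U theta.
  by move=> y; apply; [exact: (proj1 htheta)|exact: dot_theta_omega].
have Ustep v k : k != i -> U v -> dot v (alpha k) != 0 -> U (alpha k).
  move=> ki Uv vk y yperp.
  have ak := root_basis_root hbasis k.
  have : dot v (refl dot (alpha k) y) = 0.
    apply: Uv => b Pb bi; rewrite -refl_adjoint; apply: yperp.
      exact: root_refl.
    by rewrite dot_refl dot_alpha_omega (negbTE ki) mulr0 subr0.
  rewrite -refl_adjoint dot_refl (Uv _ yperp) sub0r => /eqP.
  rewrite oppr_eq0 !mulf_eq0 (negbTE vk) pnatr_eq0 invr_eq0.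
  by rewrite (negbTE (root_anisotropic ak)) => /eqP.
have Ualpha k : k != i -> U (alpha k).
  move=> ki; apply: contrapT => nU; apply: irr.
  exists (extended_diagram i `&` [set x | U x.1]),
         (extended_diagram i `&` [set x | ~ U x.1]); split.
  - exists (- theta, 1); split; first exact: extended_diagram_theta.
    by move=> y yperp; rewrite /= dotNl Utheta// oppr0.
  - by exists (alpha k, 0); split; [exact: extended_diagram_alpha|].
  - rewrite -setIUr; apply/esym/setIidPl => x _.
    by case: (pselect (U x.1)); [left|right].
  - move=> a b [_ Ua] [/extended_diagramP[->|[l li ->]] nUb].
      by exfalso; apply: nUb => y yperp; rewrite /= dotNl Utheta// oppr0.
    by apply/eqP; apply: contrapT => /negP h; apply: nUb; exact: Ustep h.
apply: alpha_nondegenerate => k.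
(* The node [i] is left over: once the other terms of [dot theta z = 0] vanish, only
   [m i * dot (alpha i) z] remains. *)
have [->|ki] := eqVneq k i; last exact: Ualpha.
have /eqP := Utheta z zperp; rewrite dot_theta (bigD1 i)//= big1 => [|l li].
  by rewrite addr0 mulf_eq0 gt_eqF ?m_gt0//= => /eqP.
by rewrite Ualpha// mulr0.
Qed.

(* The witness is the barycentre of the facet, pushed slightly outwards. *)
Lemma facet_irredundant i w : facet_index i -> W w ->
  exists2 x, m i < dot x (w (omega i)) &
    forall w' j, W w' -> dot x (w' (omega j)) <= m j \/
      [set x | dot x (w' (omega j)) <= m j] =
      [set x | dot x (w (omega i)) <= m i].
Proof.
move=> Fi Ww.
have [s PhiE] := (finite_seqP _).1 (root_finite hPhi).
pose F := [seq b <- s | dot b (omega i) == m i].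
have FP b : (b \in F) = (b \in s) && (dot b (omega i) == m i).
  by rewrite mem_filter andbC.
have Ps b : Phi b -> b \in s by rewrite PhiE.
have sP b : b \in s -> Phi b by rewrite PhiE.
pose N : R := (size F)%:R.
have N1 : 1 <= N.
  rewrite ler1n; have : theta \in F.
    by rewrite FP Ps ?dot_theta_omega ?eqxx//; exact: (proj1 htheta).
  by rewrite lt0n size_eq0; case: eqP => [->|].
(* [M] exceeds every [m j]. The factor [t = 1 / (N - 1 / M)] is slightly larger than [1 / N], so
   [t *: q] lies just beyond the barycentre. *)
pose M := 1 + \sum_k m k.
have mM j : m j < M.
  rewrite /M (bigD1 j)//=; have : 0 <= \sum_(k | k != j) m k.
    by apply: sumr_ge0 => k _; rewrite ltW ?m_gt0.
  lra.
have M1 : 1 < M by apply: le_lt_trans (mM i); exact: m_ge1.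
have NM : 0 < N - M^-1.
  by rewrite subr_gt0; apply: lt_le_trans N1; rewrite invf_lt1; lra.
pose t := (N - M^-1)^-1.
have t0 : 0 < t by rewrite invr_gt0.
pose q := \sum_(b <- F) b.
have [w' [Ww' wK w'K adj]] := weyl_inv Ww.
have adj' x y : dot x (w y) = dot (w' x) y by rewrite dotC adj dotC.
exists (w (t *: q)).
  rewrite adj' wK dotZl dot_suml big_seq (eq_bigr (fun=> m i)); last first.
    by move=> b; rewrite FP => /andP[_ /eqP].
  rewrite -big_seq big_const_seq count_predT iter_addr_0.
  rewrite -[m i *+ _]mulr_natr -/N.
  have : 0 < t * M^-1 * m i by rewrite !mulr_gt0 ?m_gt0 ?invr_gt0//; lra.
  have : t * (N - M^-1) * m i = m i by rewrite mulVf ?mul1r// gt_eqF.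
  lra.
move=> v j Wv.
have Wu : W (w' \o v) by exact: refl_group_comp.
have [u' [Wu' _ _ adju]] := weyl_inv Wu.
pose uj := w' (v (omega j)).
have vE x : dot x (v (omega j)) = dot (w' x) uj.
  by rewrite -{1}(w'K (v _)) adj'.
have dE b : b \in s -> exists k : nat, dot b uj = m j - k%:R.
  move=> /sP Pb; rewrite dotC -/((w' \o v) (omega j)) adju dotC.
  exact/root_le_theta/(weyl_root Wu').
(* Either [uj] is tight on the whole facet, hence proportional to [omega i] and giving the same
   half-space, or some root of the facet has a gap of at least 1. *)
have [allF|/existsNP[b0 /not_implyP[b0F /eqP b0N]]] :=
    pselect (forall b, b \in F -> dot b uj = m j).
  right; have : m i *: uj - m j *: omega i = 0.
    apply: (facet_span Fi) => b /Ps bs bi; rewrite dotC dotBl !dotZl.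
    by rewrite !(dotC _ b) allF ?bi ?FP ?bs ?bi ?eqxx// mulrC subrr.
  move=> /subr0_eq ujE; apply/seteqP.
  have vwE x : dot x (v (omega j)) = m j / m i * dot x (w (omega i)).
    rewrite vE adj'; apply: (mulfI (lt0r_neq0 (m_gt0 i))).
    rewrite -dotZr ujE dotZr; field; exact: lt0r_neq0 (m_gt0 i).
  have mij : 0 < m j / m i by rewrite divr_gt0 ?m_gt0.
  have mjE : m j = m j / m i * m i by rewrite divfK// gt_eqF ?m_gt0.
  by split=> x; rewrite /= vwE {2}mjE ler_pM2l.
left; rewrite vE wK dotZl dot_suml.
(* The overshoot is paid for by the gap: [t * (N * m j - 1) = m j + t * (m j / M - 1)], and
   [m j < M]. *)
suff : \sum_(b <- F) dot b uj <= N * m j - 1.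
  move=> /(ler_wpM2l (ltW t0))/le_trans; apply.
  have : t * (N - M^-1) * m j = m j by rewrite mulVf ?mul1r// gt_eqF.
  have : M^-1 * m j < 1 by rewrite mulrC ltr_pdivrMr ?mul1r//; lra.
  rewrite -(ltr_pM2l t0); lra.
suff : 1 <= \sum_(b <- F) (m j - dot b uj).
  rewrite sumrB big_const_seq count_predT iter_addr_0 -[m j *+ _]mulr_natr -/N.
  lra.
have ge0 b : b \in F -> 0 <= m j - dot b uj.
  by rewrite FP => /andP[/dE[k ->] _]; rewrite subKr.
rewrite (big_rem b0)//= -[1]addr0 lerD//.
  move: b0F b0N; rewrite FP => /andP[/dE[k ->] _].
  rewrite subKr; case: k => [|k _]; first by rewrite subr0 eqxx.
  by rewrite ler1n.
by rewrite big_seq; apply: sumr_ge0 => b /mem_rem; exact: ge0.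
Qed.

End Data.
End RootPolytope.

Theorem corollary5p6 (R : realType) (V : vectType R)
    (dot : {dot V for (idfun : R -> R)}) (n : nat)
    (Phi : set V) (alpha : 'I_n -> V) (theta : V) (m : 'I_n -> R)
    (omega : 'I_n -> V)
    (hPhi : reduced_root_system dot Phi)
    (hirr : irreducible_roots dot Phi)
    (hbasis : root_basis Phi alpha)
    (htheta : highest_root Phi alpha theta)
    (hm : theta = \sum_i m i *: alpha i)
    (homega : dual_basis dot alpha omega) :
  half_space_representation (root_polytope Phi)
    (weyl_half_spaces dot Phi omega m [set: 'I_n]) /\
  minimal_representation (root_polytope Phi)
    (weyl_half_spaces dot Phi omega m
       [set i | irreducible_roots (affine_dot dot)
                  (parabolic_subsystem dot Phi
                     (affine_simple_roots alpha theta `\ (alpha i, 0)))]).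
Proof.
have le_sub J := root_polytope_le hPhi htheta hm homega (J := J).
have sub_le := weyl_le_root_polytope hPhi hbasis htheta hm homega.
rewrite -/(facet_index dot Phi alpha theta).
split; [|split].
- rewrite /half_space_representation bigcap_weyl_half_spaces.
  by apply/seteqP; split; [exact: sub_le|exact: le_sub].
- rewrite /half_space_representation bigcap_weyl_half_spaces.
  apply/seteqP; split; last exact: le_sub.
  move=> x /(weyl_le_facet hPhi hbasis htheta hm homega); exact: sub_le.
move=> G [GF nFG] GP; apply: nFG => H [w [i [Ww Fi ->]]].
apply: contrapT => nGH.
(* [x] violates [H] only, so every half-space in [G] contains it; a pair [(v, j)] describing [H]
   again is excluded because [G] omits [H] as a set. *)
have [x xlt xle] := facet_irredundant hPhi hbasis htheta hm homega Fi Ww.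
have : root_polytope Phi x.
  rewrite -GP => K GK; have [v [j [Wv Fj KE]]] := GF _ GK; rewrite KE.
  have [//|KH] := xle v j Wv.
  by exfalso; apply: nGH; rewrite -KH -KE.
by move=> /(le_sub setT)/(_ w i Ww I); rewrite leNgt xlt.
Qed.
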